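(* Consider split conformal prediction with exchangeable data $(X_1,Y_1),\dots,(X_{n+1},Y_{n+1})$, calibration set of size $n_c\ge 1$, and lower and upper one-sided conformity score functions that are quasi-convex in $y$. Let $\alpha^-,\alpha^+\in(0,1)$, $\underline{\alpha}:=(\alpha^-,\alpha^+)$, let $\mathcal C^{L}_{n+1,\alpha^-}=[L_{n+1},+\infty)$ and $\mathcal C^{U}_{n+1,\alpha^+}=(-\infty,U_{n+1}]$ be the lower and upper one-sided split conformal prediction intervals for $Y_{n+1}$ with miscoverage levels $\alpha^-$ and $\alpha^+$ respectively, and define $$\mathcal C^{\cap}_{n+1,\underline{\alpha}}:=[L_{n+1},U_{n+1}]=\mathcal C^{L}_{n+1,\alpha^-}\cap\mathcal C^{U}_{n+1,\alpha^+}.$$ (i) If the one-sided marginal guarantees $$\mathbb P\big(Y_{n+1}\in\mathcal C^{L}_{n+1,\alpha^-}\big)\ge 1-\alpha^-,\qquad \mathbb P\big(Y_{n+1}\in\mathcal C^{U}_{n+1,\alpha^+}\big)\ge 1-\alpha^+$$ hold, then $$1-(\alpha^-+\alpha^+)\;\le\;\mathbb P\big(Y_{n+1}\in\mathcal C^{\cap}_{n+1,\underline{\alpha}}\big).$$ (ii) If, moreover, the corresponding scores are almost surely distinct, so that $$\mathbb P\big(Y_{n+1}\in\mathcal C^{L}_{n+1,\alpha^-}\big)\le 1-\alpha^-+\frac1{n_c+1},\qquad \mathbb P\big(Y_{n+1}\in\mathcal C^{U}_{n+1,\alpha^+}\big)\le 1-\alpha^++\frac1{n_c+1},$$ then $$1-(\alpha^-+\alpha^+)\;\le\;\mathbb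 P\big(Y_{n+1}\in\mathcal C^{\cap}_{n+1,\underline{\alpha}}\big)\;\le\;1-\max\{\alpha^-,\alpha^+\}+\frac1{n_c+1}.$$ In particular, if $\alpha^-=\alpha^+=\alpha/2$, then $$1-\alpha\;\le\;\mathbb P\big(Y_{n+1}\in\mathcal C^{\cap}_{n+1,\underline{\alpha}}\big)\;\le\;1-\frac{\alpha}{2}+\frac1{n_c+1}.$$
   Context: Setting: $(X_i,Y_i)$, $i=1,\dots,n+1$, are random pairs with $X_i\in\mathbb R^p$, $Y_i\in\mathbb R$; the sequence of $n+1$ pairs is exchangeable. The first $n$ pairs are partitioned into a proper training set of size $n_t$, on which predictive models are fitted, and a calibration set of size $n_c$. One-sided scores: $s^L(x,y)$ and $s^U(x,y)$ are real-valued functions built from the proper training set only. Examples are $s^L(x,y)=\hat f(x)-y$ and $s^U(x,y)=y-\hat f(x)$ with $\hat f$ a fitted regression function; the same two quantities divided by a fitted conditional standard deviation $\hat\sigma(x)>0$; or $s^L(x,y)=\hat q_{\alpha^-}(x)-y$ and $s^U(x,y)=y-\hat q_{1-\alpha^+}(x)$ with $\hat q_\tau$ a fitted conditional $\tau$-quantile. The scores are quasi-convex in $y$, and the one-sided sets below are half-lines of the indicated form (with $L_{n+1}=-\infty$ or $U_{n+1}=+\infty$ allowed, in which case the set is $\mathbb R$; $[L_{n+1},U_{n+1}]$ denotes $\{y\in\mathbb R: L_{n+1}\le y\le U_{n+1}\}$). One-sided intervals: for $\bullet\in\{L,U\}$ and level $a\in(0,1)$, $$\mathcal C^{\bullet}_{n+1,a}=\{y\in\mathbb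 R:\ s^\bullet(X_{n+1},y)\le Q^\bullet_{a,n_c}\},$$ where $Q^\bullet_{a,n_c}$ is the empirical $(1-a)(1+1/n_c)$-quantile of the $n_c$ calibration scores $s^\bullet(X_i,Y_i)$, i.e. their $\lceil(1-a)(n_c+1)\rceil$-th smallest value ($+\infty$ if this index exceeds $n_c$). One has $\mathcal C^{L}_{n+1,\alpha^-}=[L_{n+1},+\infty)$ and $\mathcal C^{U}_{n+1,\alpha^+}=(-\infty,U_{n+1}]$. ''The scores are almost surely distinct'' means that, for each $\bullet\in\{L,U\}$, the $n_c$ calibration scores together with the test score $s^\bullet(X_{n+1},Y_{n+1})$ are pairwise distinct almost surely. Probabilities are over the joint distribution of all $n+1$ pairs. *)

(* Defs.v *)
From mathcomp Require Import all_boot all_order all_algebra perm.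
From mathcomp Require Import all_classical all_reals all_analysis.

Set Implicit Arguments.
Unset Strict Implicit.
Unset Printing Implicit Defensive.

Import Order.TTheory GRing.Theory Num.Theory.
Import numFieldNormedType.Exports.

Local Open Scope classical_set_scope.
Local Open Scope ring_scope.

Definition quasi_convex (R : realType) (f : R -> R) : Prop :=
  forall y z t : R, 0 <= t <= 1 ->
    f (t * y + (1 - t) * z) <= Num.max (f y) (f z).

(* The joint law is a law on [m.-tuple T], which carries the product
   sigma-algebra. *)
Definition exchangeable d d' (Omega : measurableType d) (T : measurableType d')
    (R : realType) (P : probability Omega R) (m : nat)
    (Z : 'I_m -> {RV P >-> T}) : Prop :=
  forall (sigma : 'S_m) (A : set (m.-tuple T)), measurable A ->
    pushforward P (fun w => [tuple Z (sigma i) w | i < m]) A =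
    pushforward P (fun w => [tuple Z i w | i < m]) A.

(* A pair (covariates in R^p, response); [p.-tuple R] carries the Borel
   sigma-algebra of R^p. *)
Notation obs R p := (p.-tuple R * R)%type.

(* [score] is allowed to depend on the training sample in an arbitrary way
   (this is where the fitted models enter). *)
Definition score (R : realType) (p n_t : nat) : Type :=
  n_t.-tuple (obs R p) -> p.-tuple R -> R -> R.

Definition measurable_score (R : realType) (p n_t : nat) (s : score R p n_t) :
    Prop :=
  measurable_fun setT
    (fun u : n_t.-tuple (obs R p) * p.-tuple R * R => s u.1.1 u.1.2 u.2).

(* [tr] and [cal] enumerate the two blocks of a partition of the first [n]
   indices. *)
Definition split_indices (n n_t n_c : nat)
    (tr : 'I_n_t -> 'I_n) (cal : 'I_n_c -> 'I_n) : Prop :=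
  bijective (fun u : 'I_n_t + 'I_n_c =>
    match u with inl j => tr j | inr k => cal k end).

(* The ceil((1 - a)(n_c + 1))-th smallest element of the sequence, where [n_c]
   is its size; this rank is at least 1 when a < 1. *)
Definition conformal_quantile (R : realType) (a : R) (s : seq R) : \bar R :=
  let k := `|Num.ceil ((1 - a) * (size s).+1%:R)|%N in
  if (k <= size s)%N then (nth 0 (sort <=%R s) k.-1)%:E else +oo%E.

Section SplitConformal.
Context d (Omega : measurableType d) (R : realType) (P : probability Omega R).
Context (p n n_t n_c : nat).
Variables (tr : 'I_n_t -> 'I_n) (cal : 'I_n_c -> 'I_n).
Variable Z : 'I_n.+1 -> {RV P >-> obs R p}.

Definition past (i : 'I_n) : 'I_n.+1 := widen_ord (leqnSn n) i.

Definition training (w : Omega) : n_t.-tuple (obs R p) :=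
  [tuple Z (past (tr j)) w | j < n_t].

Definition X_new (w : Omega) : p.-tuple R := (Z ord_max w).1.
Definition Y_new (w : Omega) : R := (Z ord_max w).2.

Definition cal_scores (s : score R p n_t) (w : Omega) : n_c.-tuple R :=
  [tuple s (training w) (Z (past (cal k)) w).1 (Z (past (cal k)) w).2
    | k < n_c].

Definition test_score (s : score R p n_t) (w : Omega) : R :=
  s (training w) (X_new w) (Y_new w).

Definition one_sided_set (s : score R p n_t) (a : R) (w : Omega) : set R :=
  [set y | ((s (training w) (X_new w) y)%:E
            <= conformal_quantile a (cal_scores s w))%E].

Definition as_distinct_scores (s : score R p n_t) : Prop :=
  {ae P, forall w, uniq (test_score s w :: cal_scores s w)}.

End SplitConformal.

(* The set of reals y with L <= y <= U, the endpoints being extended reals. *)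
Definition real_interval (R : realType) (L U : \bar R) : set R :=
  [set y | (L <= y%:E <= U)%E].

(* Main.v *)
(* The response lies in the one-sided set of level a iff fewer than
   k = ceil((1 - a)(n_c + 1)) calibration scores are below the test score, that
   is, iff the rank of the test score among the n_c + 1 held-out scores is less
   than k. Swapping the test pair with a calibration pair fixes the training
   sample, so by exchangeability every held-out score has rank less than k with
   the same probability. If the scores are distinct, at most k of them have rank
   less than k; taking expectations, this probability is at most
   k / (n_c + 1) < 1 - a + 1 / (n_c + 1). The intersection then inherits this
   upper bound by monotonicity, and its lower bound is the union bound. *)
Require Import Defs.
From mathcomp Require Import all_boot all_order all_algebra perm.
From mathcomp Require Import all_classical all_reals all_analysis.
From mathcomp Require Import measurable_realfun lra.

Set Implicit Arguments.
Unset Strict Implicit.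
Unset Printing Implicit Defensive.

Import Order.TTheory GRing.Theory Num.Theory.

Local Open Scope classical_set_scope.
Local Open Scope ring_scope.

(** * Ranks in a finite family and the conformal quantile *)

Definition rank (R : realType) (J : finType) (f : J -> R) (j : J) : nat :=
  (\sum_(i : J) (f i < f j)%R)%N.

Lemma rank_perm (R : realType) (J : finType) (pi : {perm J}) (f : J -> R) j :
  rank (f \o pi) j = rank f (pi j).
Proof. by rewrite /rank [RHS](reindex_inj (@perm_inj _ pi)). Qed.

Lemma rank_lt (R : realType) (J : finType) (f : J -> R) i j :
  f i < f j -> (rank f i < rank f j)%N.
Proof.
(* The term of index [i] is isolated in both sums: it is 0 on the left and 1 on the right, which
   makes the inequality strict. *)
move=> fij; rewrite /rank (bigD1 i)//= [X in (_ < X)%N](bigD1 i)//= ltxx fij.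
rewrite add0n add1n ltnS; apply: leq_sum => l _.
by case: ltP => // /lt_trans/(_ fij) ->.
Qed.

Lemma rank_inj (R : realType) (J : finType) (f : J -> R) :
  injective f -> injective (rank f).
Proof.
move=> finj i j; case: (ltgtP (f i) (f j)) => [| |/finj //] /rank_lt lt_ij eq_ij.
all: by rewrite eq_ij ltnn in lt_ij.
Qed.

(** Distinct values have distinct ranks, so the indices counted here inject into the [k] naturals
    below [k]. *)
Lemma sum_rank_lt (R : realType) (J : finType) (f : J -> R) k :
  injective f -> (\sum_(j : J) (rank f j < k) <= k)%N.
Proof.
move=> /rank_inj rinj.
rewrite -big_mkcond/= sum1_card cardE -(size_map (rank f)) -[leqRHS](size_iota 0).
apply: uniq_leq_size; first by rewrite map_inj_uniq ?enum_uniq.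
by move=> _ /mapP[j + ->]; rewrite mem_enum mem_iota.
Qed.

Lemma rank_None (R : realType) n (f : option 'I_n -> R) :
  rank f None = count (< f None) [tuple f (Some i) | i < n].
Proof.
rewrite /rank (bigD1 None)//= ltxx add0n.
rewrite (reindex_omap Some id) => [|[]//].
rewrite -sum1_count big_map/= [RHS]big_mkcond/= big_enum/=.
by apply: eq_big => [i|i _]; [rewrite eqxx|case: ifP => // ->].
Qed.

(** A number is at most the k-th smallest entry exactly when fewer than k entries lie strictly below
    it. If k exceeds the size, both sides are true. *)
Lemma le_conformal_quantile (R : realType) (a : R) (s : seq R) (t : R) :
  a < 1 ->
  (t%:E <= conformal_quantile a s)%E =
  (count (< t) s < `|Num.ceil ((1 - a) * (size s).+1%:R)|)%N.
Proof.
move=> a1; rewrite /conformal_quantile.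
have : (0 < `|Num.ceil ((1 - a) * (size s).+1%:R)|)%N.
  by rewrite absz_gt0 gt_eqF// ceil_gt0 mulr_gt0// subr_gt0.
(* The rank is positive because [a < 1]. From here on it is [k.+1], and [k] is the zero-based index
   in the sorted sequence. *)
case: `|_|%N => // k _ /=; case: ifPn => [ks|]; last first.
  rewrite -leqNgt leey ltnS => sk; apply/esym.
  exact: leq_trans (count_size _ _) sk.
rewrite lee_fin ltnS; have sp : perm_eq (sort <=%R s) s by rewrite perm_sort.
rewrite -(seq.permP sp); have ss := sort_le_sorted s.
apply/idP/idP => [tk|ck].
  rewrite leqNgt; apply: contraTN tk => /(nth_count_lt 0 ss).
  by rewrite -ltNge.
by apply: nth_count_ge; rewrite // ck size_sort.
Qed.

(** * Measurability and probability of rank events *)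

Lemma indic_bool T (R : realType) (b : T -> bool) (x : T) :
  \1_[set y | b y] x = (b x)%:R :> R.
Proof.
rewrite indicE; suff -> : (x \in [set y | b y]) = b x by [].
by apply/idP/idP; rewrite inE.
Qed.

Lemma measurable_rank_lt d (T : measurableType d) (R : realType) (J : finType)
    (h : J -> T -> R) (j : J) (k : nat) :
  (forall i, measurable_fun setT (h i)) ->
  measurable [set x | (rank (h^~ x) j < k)%N].
Proof.
move=> mh.
(* The rank as a real-valued sum of indicators: measurable, with the event as the preimage of a
   half-line. *)
pose F x := \sum_(i : J) (\1_[set y | h i y < h j y] x : R).
have FE x : F x = (rank (h^~ x) j)%:R.
  by rewrite /rank natr_sum; apply: eq_bigr => i _; rewrite indic_bool.
have mF : measurable_fun setT F.
  apply: measurable_sum => i; apply: measurable_indic.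
  have := measurable_fun_ltr (mh i) (mh j) measurableT (Y := [set true]) I.
  by rewrite setTI preimage_true.
rewrite (_ : [set x | _] = F @^-1` `]-oo, k%:R[).
  by rewrite -[X in measurable X]setTI; exact: mF.
by apply/seteqP; split => x /=; rewrite in_itv/= FE ltr_nat.
Qed.

Section RankProbability.
Context d (Omega : measurableType d) (R : realType) (P : probability Omega R).
Local Open Scope ereal_scope.

(** The number of indices of rank below [k] is almost surely at most [k], while its expectation is
    [#|J|] times the common probability. *)
Lemma rank_lt_probability_le (J : finType) (h : J -> Omega -> R) (j0 : J)
    (k : nat) :
  (forall i, measurable_fun setT (h i)) ->
  (forall j, P [set w | (rank (h^~ w) j < k)%N] =
             P [set w | (rank (h^~ w) j0 < k)%N]) ->
  {ae P, forall w, injective (h^~ w)} ->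
  P [set w | (rank (h^~ w) j0 < k)%N] <= (k%:R / #|J|%:R)%:E.
Proof.
move=> mh Pj ae_inj; set p := P _ in Pj *.
pose A j := [set w | (rank (h^~ w) j < k)%N].
have mA j : measurable (A j) by exact: measurable_rank_lt.
have mI j : measurable_fun setT (fun w => (\1_(A j) w : R)%:E).
  by apply/measurable_EFinP; exact: measurable_indic.
have pfin : p \is a fin_num by apply: fin_num_measure; exact: (mA j0).
have : \int[P]_w (\sum_(j : J) (\1_(A j) w : R)%:E) <= \int[P]_w (cst k%:R%:E w).
  apply: ae_ge0_le_integral => //.
  - by move=> w _; apply: sume_ge0 => j _; rewrite lee_fin.
  - exact: emeasurable_sum.
  - by move=> w _; rewrite lee_fin.
  apply: filterS ae_inj => w winj _; rewrite sumEFin lee_fin.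
  apply: (@le_trans _ _ (\sum_(j : J) (rank (h^~ w) j < k)%N)%:R%R).
    by rewrite natr_sum; apply: ler_sum => j _; rewrite indic_bool.
  by rewrite ler_nat; exact: sum_rank_lt.
rewrite ge0_integral_sum//.
rewrite integral_cst// [X in _ * X](_ : _ = 1); last exact: probability_setT.
rewrite mule1 (eq_bigr (fun=> p)); last first.
  by move=> j _; rewrite integral_indic// setIT; exact: Pj.
rewrite -(fineK pfin) sumEFin !lee_fin sumr_const -(mulr_natr (fine p)) => kp.
rewrite ler_pdivlMr// ltr0n; apply/card_gt0P; by exists j0.
Qed.

End RankProbability.

Lemma probability_setI_ge d (Omega : measurableType d) (R : realType)
    (P : probability Omega R) (A B : set Omega) (a b : R) :
  measurable A -> measurable B ->
  ((1 - a)%:E <= P A)%E -> ((1 - b)%:E <= P B)%E ->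
  ((1 - (a + b))%:E <= P (A `&` B))%E.
Proof.
move=> mA mB.
have finP C : measurable C -> P C \is a fin_num by exact: fin_num_measure.
(* The left-hand side is the probability of the union. *)
have : (P A + P B - P (A `&` B) <= 1)%E.
  rewrite -measureUfinr//; last by rewrite ltey_eq finP.
  by apply: probability_le1; exact: measurableU.
have [[fA fB] fI] := (finP _ mA, finP _ mB, finP _ (measurableI _ _ mA mB)).
by rewrite -(fineK fA) -(fineK fB) -(fineK fI) -EFinD !lee_fin; lra.
Qed.

Section ExchangeableRank.
Context d d' (Omega : measurableType d) (T : measurableType d') (R : realType).
Variables (P : probability Omega R) (m : nat) (Z : 'I_m -> {RV P >-> T}).

(** The last hypothesis says that swapping the observations [e j] and [e l] only swaps the scores
    [j] and [l]. Hence the event for [l] on the swapped sample is the event for [j] on the original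
    one, and both samples have the same law. *)
Lemma exchangeable_rank_lt (J : finType) (e : J -> 'I_m)
    (h : J -> m.-tuple T -> R) (k : nat) :
  exchangeable Z -> (forall i, measurable_fun setT (h i)) ->
  (forall (j l : J) (z : m.-tuple T),
    (fun i => h i [tuple tnth z (tperm (e j) (e l) i') | i' < m]) =
    (fun i => h (tperm j l i) z)) ->
  forall j l,
    P [set w | (rank (fun i => h i [tuple Z i' w | i' < m]) j < k)%N] =
    P [set w | (rank (fun i => h i [tuple Z i' w | i' < m]) l < k)%N].
Proof.
move=> exZ mh hperm j l.
have := exZ (tperm (e j) (e l)) _ (measurable_rank_lt l k mh).
rewrite /pushforward/= => <-; congr (P _); apply/seteqP; split => w /=.
all: have -> : [tuple Z (tperm (e j) (e l) i) w | i < m] =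
  [tuple tnth [tuple Z i' w | i' < m] (tperm (e j) (e l) i) | i < m]
  by apply: eq_from_tnth => i; rewrite !tnth_mktuple.
all: by rewrite hperm (rank_perm _ (fun i => h i _)) tpermR.
Qed.

End ExchangeableRank.

(** * Held-out scores and the coverage upper bound *)

Section SplitConformalCoverage.
Context d (Omega : measurableType d) (R : realType) (P : probability Omega R).
Context (p n n_t n_c : nat).
Variables (tr : 'I_n_t -> 'I_n) (cal : 'I_n_c -> 'I_n).
Hypothesis split : split_indices tr cal.
Variable Z : 'I_n.+1 -> {RV P >-> obs R p}.
Variable s : score R p n_t.
Hypothesis meas_s : measurable_score s.
Variable a : R.
Hypothesis a1 : a < 1.

(* [None] stands for the test observation. *)
Definition held_out (i : option 'I_n_c) : 'I_n.+1 :=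
  if i is Some k then past (cal k) else ord_max.

(** The score is a function of the whole sample, training part included, since exchangeability acts
    on the joint law. *)
Definition sample_score (i : option 'I_n_c) (z : n.+1.-tuple (obs R p)) : R :=
  s [tuple tnth z (past (tr j)) | j < n_t]
    (tnth z (held_out i)).1 (tnth z (held_out i)).2.

Definition sample (w : Omega) : n.+1.-tuple (obs R p) :=
  [tuple Z i w | i < n.+1].

Lemma held_out_inj : injective held_out.
Proof.
have [g gK _] := split.
have pastD k : past (cal k) <> ord_max.
  by move=> /(congr1 val)/= e; have := ltn_ord (cal k); rewrite e ltnn.
move=> [k|] [l|] //=; last 2 first.
- by move=> /pastD.
- by move=> /esym/pastD.
move=> /(congr1 val)/= /val_inj ekl; congr Some.
by have := gK (inr k); rewrite ekl (gK (inr l)) => -[].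
Qed.

Lemma training_neq_held_out j i : held_out i != past (tr j).
Proof.
have [g gK _] := split.
apply/eqP => /(congr1 val); case: i => [k|] /= e; last first.
  by have := ltn_ord (tr j); rewrite -e ltnn.
by have := gK (inl j); rewrite -(val_inj e) (gK (inr k)).
Qed.

Lemma measurable_sample_score i : measurable_fun setT (sample_score i).
Proof.
pose F (z : n.+1.-tuple (obs R p)) :=
  ([tuple tnth z (past (tr j)) | j < n_t],
    (tnth z (held_out i)).1, (tnth z (held_out i)).2).
suff mF : measurable_fun setT F by exact: (measurableT_comp meas_s mF).
apply: measurable_fun_pair; [apply: measurable_fun_pair|].
- apply/measurable_fun_tnthP => j.
  apply: (eq_measurable_fun (@tnth _ (obs R p) ^~ (past (tr j)))) => [z _|].
    by rewrite /= tnth_mktuple.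
  exact: measurable_tnth.
- exact: measurableT_comp measurable_fst (measurable_tnth _).
- exact: measurableT_comp measurable_snd (measurable_tnth _).
Qed.

Lemma measurable_sample : measurable_fun setT sample.
Proof.
apply/measurable_fun_tnthP => j.
apply: (eq_measurable_fun (Z j)) => [w _|]; first by rewrite /= tnth_mktuple.
exact: measurable_funPT.
Qed.

(** A swap of two held-out positions moves no training position, so the fitted score function stays
    the same and only its arguments are exchanged. *)
Lemma sample_score_tperm j l (z : n.+1.-tuple (obs R p)) :
  (fun i => sample_score i
    [tuple tnth z (tperm (held_out j) (held_out l) i') | i' < n.+1]) =
  (fun i => sample_score (tperm j l i) z).
Proof.
apply/funext => i; rewrite /sample_score !tnth_mktuple.
rewrite (inj_tperm _ _ _ held_out_inj); congr (s _ _ _).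
apply: eq_from_tnth => t; rewrite !tnth_mktuple tpermD //.
all: exact: training_neq_held_out.
Qed.

Lemma sample_scoreE w i : sample_score i (sample w) =
  if i is Some k then tnth (cal_scores tr cal Z s w) k
  else test_score tr Z s w.
Proof.
rewrite /sample_score tnth_mktuple.
have -> : [tuple tnth (sample w) (past (tr j)) | j < n_t] = training tr Z w.
  by apply: eq_from_tnth => j; rewrite !tnth_mktuple.
by case: i => //= k; rewrite tnth_mktuple.
Qed.

Let k := `|Num.ceil ((1 - a) * n_c.+1%:R)|%N.

Lemma one_sided_set_rank :
  [set w | one_sided_set tr cal Z s a w (Y_new Z w)] =
  [set w | (rank (fun i => sample_score i (sample w)) None < k)%N].
Proof.
have E w : one_sided_set tr cal Z s a w (Y_new Z w) =
    (rank (fun i => sample_score i (sample w)) None < k)%N.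
  rewrite -[LHS]/(is_true ((test_score tr Z s w)%:E
    <= conformal_quantile a (cal_scores tr cal Z s w))%E).
  rewrite le_conformal_quantile// size_tuple -/k.
  have <- : [tuple sample_score (Some i) (sample w) | i < n_c] =
      cal_scores tr cal Z s w.
    by apply: eq_from_tnth => i; rewrite tnth_mktuple sample_scoreE.
  by rewrite rank_None sample_scoreE.
by apply/seteqP; split => w /=; rewrite E.
Qed.

Lemma measurable_one_sided_set :
  measurable [set w | one_sided_set tr cal Z s a w (Y_new Z w)].
Proof.
rewrite one_sided_set_rank; apply: measurable_rank_lt => i.
exact: measurableT_comp (measurable_sample_score i) measurable_sample.
Qed.

Lemma coverage_upper_bound :
  exchangeable Z -> as_distinct_scores tr cal Z s ->
  (P [set w | one_sided_set tr cal Z s a w (Y_new Z w)]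
   <= (1 - a + n_c.+1%:R^-1)%:E)%E.
Proof.
move=> exZ dist; rewrite one_sided_set_rank.
apply: (@le_trans _ _ (k%:R / #|{: option 'I_n_c}|%:R)%:E).
  apply: rank_lt_probability_le => [i|j|].
  - exact: measurableT_comp (measurable_sample_score i) measurable_sample.
  - exact: exchangeable_rank_lt exZ measurable_sample_score sample_score_tperm _ _.
  (* Distinctness as a list becomes injectivity on [option 'I_n_c]: the tail handles two calibration
     scores, the head a calibration score against the test score. *)
  apply: filterS dist => w; rewrite cons_uniq => /andP[test_cal /tuple_uniqP cal_inj].
  move=> [i|] [j|]; rewrite !sample_scoreE //.
  - by move=> e; rewrite (cal_inj _ _ e).
  - by move=> e; rewrite -e mem_tnth in test_cal.
  - by move=> e; rewrite e mem_tnth in test_cal.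
rewrite lee_fin card_option card_ord ler_pdivrMr// mulrDl mulVf//.
(* Positivity makes the absolute value in [k] harmless; what remains is that the ceiling of x is
   less than x + 1. *)
have x0 : 0 < (1 - a) * n_c.+1%:R by rewrite mulr_gt0// subr_gt0.
rewrite /k natr_absz gtr0_norm ?ceil_gt0// -lerBlDr -[X in _ - X]/(1%:~R) -intrB.
exact/ltW/ceilB1_lt.
Qed.

End SplitConformalCoverage.

Theorem theorem4p1 (d : measure_display) (Omega : measurableType d)
    (R : realType) (P : probability Omega R)
    (p n n_t n_c : nat) (n_c_ge1 : (1 <= n_c)%N)
    (tr : 'I_n_t -> 'I_n) (cal : 'I_n_c -> 'I_n)
    (split : split_indices tr cal)
    (Z : 'I_n.+1 -> {RV P >-> obs R p}) (exchZ : exchangeable Z)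
    (sL sU : score R p n_t)
    (meas_sL : measurable_score sL) (meas_sU : measurable_score sU)
    (qc_sL : forall D x, quasi_convex (sL D x))
    (qc_sU : forall D x, quasi_convex (sU D x))
    (am ap : R) (am01 : 0 < am < 1) (ap01 : 0 < ap < 1)
    (L U : Omega -> \bar R)
    (CL_eq : forall w, one_sided_set tr cal Z sL am w = [set y | (L w <= y%:E)%E])
    (CU_eq : forall w, one_sided_set tr cal Z sU ap w = [set y | (y%:E <= U w)%E]) :
  let PL := P [set w | one_sided_set tr cal Z sL am w (Y_new Z w)] in
  let PU := P [set w | one_sided_set tr cal Z sU ap w (Y_new Z w)] in
  let Pcap := P [set w | real_interval (L w) (U w) (Y_new Z w)] in
  [/\ (forall w, real_interval (L w) (U w) =
         one_sided_set tr cal Z sL am w `&` one_sided_set tr cal Z sU ap w),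
      (((1 - am)%:E <= PL)%E -> ((1 - ap)%:E <= PU)%E ->
        ((1 - (am + ap))%:E <= Pcap)%E)
    & (((1 - am)%:E <= PL)%E -> ((1 - ap)%:E <= PU)%E ->
        as_distinct_scores tr cal Z sL -> as_distinct_scores tr cal Z sU ->
        [/\ (PL <= (1 - am + (n_c.+1%:R)^-1)%:E)%E,
            (PU <= (1 - ap + (n_c.+1%:R)^-1)%:E)%E,
            ((1 - (am + ap))%:E <= Pcap
              <= (1 - Num.max am ap + (n_c.+1%:R)^-1)%:E)%E
          & forall alpha : R, am = alpha / 2 -> ap = alpha / 2 ->
            ((1 - alpha)%:E <= Pcap
              <= (1 - alpha / 2 + (n_c.+1%:R)^-1)%:E)%E])].

Proof.
move=> PL PU Pcap.
have capE w : real_interval (L w) (U w) =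
    one_sided_set tr cal Z sL am w `&` one_sided_set tr cal Z sU ap w.
  rewrite CL_eq CU_eq; apply/seteqP; split => y /=.
    by move=> /andP[].
  by move=> [yL yU]; apply/andP.
have [/andP[_ am1] /andP[_ ap1]] := (am01, ap01).
pose AL := [set w | one_sided_set tr cal Z sL am w (Y_new Z w)].
pose AU := [set w | one_sided_set tr cal Z sU ap w (Y_new Z w)].
have mAL : measurable AL by exact: measurable_one_sided_set.
have mAU : measurable AU by exact: measurable_one_sided_set.
have PcapE : Pcap = P (AL `&` AU).
  by congr (P _); apply/seteqP; split => w /=; rewrite capE.
have lower : ((1 - am)%:E <= PL)%E -> ((1 - ap)%:E <= PU)%E ->
    ((1 - (am + ap))%:E <= Pcap)%E.
  by rewrite PcapE; exact: probability_setI_ge.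
split => // hL hU dL dU.
have uL := coverage_upper_bound split meas_sL am1 exchZ dL.
have uU := coverage_upper_bound split meas_sU ap1 exchZ dU.
have both : ((1 - (am + ap))%:E <= Pcap
    <= (1 - Num.max am ap + (n_c.+1%:R)^-1)%:E)%E.
  (* The intersection is bounded by the one-sided event with the larger miscoverage level, which has
     the smaller upper bound. *)
  rewrite lower//= PcapE; case: (leP am ap) => _.
  - by apply: le_trans uU; rewrite le_measure ?inE//; exact: measurableI.
  - by apply: le_trans uL; rewrite le_measure ?inE//; exact: measurableI.
split => // alpha ea eb; move: both; rewrite ea eb maxxx.
by rewrite -splitr.
Qed.
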